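(* Suppose a planar curve rotating about the $x$-axis, $$\Gamma(x,t)=(x,\cos(t)f(x),-\sin(t)f(x)),$$ with $f$ a smooth real function on an open interval, is a solution of the Vortex Filament Equation $\partial_t\Gamma=\partial_s\Gamma\times\partial_{ss}\Gamma$. Then $f$ satisfies the second order nonlinear differential equation $$f(x)+\frac{f''(x)}{(1+f'(x)^2)^{3/2}}=0.$$
   Context: $s$ denotes arclength along the curve $x\mapsto\Gamma(x,t)$, so $\partial_s=|\partial_x\Gamma|^{-1}\partial_x=(1+f'(x)^2)^{-1/2}\partial_x$. At each time the curve $\Gamma(\cdot,t)$ lies in a single plane containing the $x$-axis, and this plane rotates about the $x$-axis with unit angular speed. *)

(* Defs.v *)
From HB Require Import structures.
From mathcomp Require Import all_boot all_order all_algebra.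
From mathcomp Require Import all_classical all_reals all_analysis.

Set Implicit Arguments.
Unset Strict Implicit.
Unset Printing Implicit Defensive.

Import Order.TTheory GRing.Theory Num.Theory.
Import numFieldNormedType.Exports.

Local Open Scope ring_scope.
Local Open Scope classical_set_scope.

Definition vec3 (R : realType) (a b c : R) : 'rV[R]_3 :=
  \row_(i < 3) [:: a; b; c]`_i.

(* The library norm on ['rV[R]_3] is the sup norm; arclength needs this one. *)
Definition enorm (R : realType) (u : 'rV[R]_3) : R :=
  Num.sqrt (\sum_(i < 3) u ord0 i ^+ 2).

Definition crossv (R : realType) (u v : 'rV[R]_3) : 'rV[R]_3 :=
  let x := fun w : 'rV[R]_3 => w ord0 (inord 0) in
  let y := fun w : 'rV[R]_3 => w ord0 (inord 1) in
  let z := fun w : 'rV[R]_3 => w ord0 (inord 2) in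
  vec3 (y u * z v - z u * y v)
       (z u * x v - x u * z v)
       (x u * y v - y u * x v).

(* [I] is meant to be open, so that the values of [f] outside [I] do not
   matter for its iterated derivatives on [I]. *)
Definition smooth_on (R : realType) (I : set R) (f : R -> R) : Prop :=
  forall (n : nat) (x : R), I x -> derivable (derive1n n f) x 1.

(* The derivative of [g] with respect to the arclength of [gamma], both being
   parametrized by the same variable. *)
Definition arclength_derive (R : realType) (gamma g : R -> 'rV[R]_3) :
    R -> 'rV[R]_3 :=
  fun x => (enorm (derive1 gamma x))^-1 *: derive1 g x.

(* [Gamma x t]: [x] is the parameter along the curve and [t] is time.
   [derive1] is total, so the equation is meaningful when [Gamma] is smooth in
   each variable on the open set [I `*` J] and [fun x => Gamma x t] is
   immersed. *)
Definition vortex_filament_equation (R : realType) (I J : set R)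
    (Gamma : R -> R -> 'rV[R]_3) : Prop :=
  forall x t : R, I x -> J t ->
    let gamma := fun y : R => Gamma y t in
    let Ds := arclength_derive gamma in
    derive1 (fun s : R => Gamma x s) t = crossv (Ds gamma x) (Ds (Ds gamma) x).

Definition rotating_curve (R : realType) (f : R -> R) :
    R -> R -> 'rV[R]_3 :=
  fun x t => vec3 x (cos t * f x) (- sin t * f x).

(* Main.v *)
Require Import Defs.
From HB Require Import structures.
From mathcomp Require Import all_boot all_order all_algebra.
From mathcomp Require Import all_classical all_reals all_analysis.
From mathcomp Require Import ring.

Import Order.TTheory GRing.Theory Num.Theory.
Import numFieldNormedType.Exports.

Local Open Scope ring_scope.
Local Open Scope classical_set_scope.

(** The vortex filament equation can be read off from the first two ordinary
    derivatives of the curve.  Writing [v] for the velocity [Gamma_x] and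
    [w = |v|], the unit tangent is [T = v / w] and its arclength derivative is
    [w^-1 *: (w^-1)' *: v + w^-2 *: v'].  The first summand is parallel to [T],
    so the derivative of the speed drops out of the cross product and
    [T x T_s = w^-3 *: (v x v')]: this is [crossv_arclength_derive].

    For the rotating curve at a time [t] with [c = cos t] and [s = sin t],
    [v = (1, c f', - s f')] and [v' = (0, c f'', - s f'')], so that
    [w^2 = 1 + f'^2] and [v x v' = (0, s f'', c f'')], while the time derivative
    of the curve is [(0, - s f, - c f)].  Hence the equation says
    [s (f + w^-3 f'') = 0] and [c (f + w^-3 f'') = 0], and as [c] and [s] do not
    vanish together, a single time [t] suffices to conclude. *)

(** * Derivatives of vector-valued curves *)

Lemma is_derive_mx (R : realType) (m n : nat) (M : R -> 'M[R]_(m, n)) (x v : R)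
    (dM : 'M[R]_(m, n)) :
  (forall i j, is_derive x v (fun y => M y i j) (dM i j)) ->
  is_derive x v M dM.
Proof.
move=> hM.
have dMx : derivable M x v by apply/derivable_mxP => i j; exact: ex_derive.
apply: DeriveDef => //; rewrite derive_mx//; apply/matrixP => i j.
by rewrite mxE derive_val.
Qed.

Lemma is_derive_vec3 (R : realType) (a b c : R -> R) (x da db dc : R) :
  is_derive x 1 a da -> is_derive x 1 b db -> is_derive x 1 c dc ->
  is_derive x 1 (fun y => vec3 (a y) (b y) (c y)) (vec3 da db dc).
Proof.
move=> ha hb hc; apply: is_derive_mx => i j.
rewrite mxE; under eq_fun do rewrite mxE.
by case: j => [[|[|[|]]]].
Qed.

Lemma is_derive_scalemx (R : realType) (m n : nat) (p : R -> R)
    (M : R -> 'M[R]_(m, n)) (x dp : R) (dM : 'M[R]_(m, n)) :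
  is_derive x 1 p dp -> is_derive x 1 M dM ->
  is_derive x 1 (fun y => p y *: M y) (dp *: M x + p x *: dM).
Proof.
move=> hp [hM <-]; apply: is_derive_mx => i j.
have hMij : is_derive x 1 (fun y => M y i j) ('D_1 M x i j).
  by rewrite derive_mx// mxE; apply: derivableP; move/derivable_mxP : hM; apply.
rewrite !mxE; under eq_fun do rewrite mxE.
by apply: is_derive_eq; rewrite /GRing.scale /=; ring.
Qed.

(** Away from the origin the Euclidean norm is the square root of a positive
    polynomial in the coordinates. *)
Lemma derivable_enorm (R : realType) (u : R -> 'rV[R]_3) (x : R) :
  enorm (u x) != 0 -> derivable u x 1 -> derivable (@enorm R \o u) x 1.
Proof.
move=> u0 hu.
have S_gt0 : 0 < \sum_(i < 3) u x ord0 i ^+ 2.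
  rewrite lt_neqAle sumr_ge0 ?andbT// => [|i _]; last exact: sqr_ge0.
  by apply: contraNneq u0 => S0; rewrite /enorm -S0 sqrtr0.
have hS : derivable (fun y => \sum_(i < 3) u y ord0 i ^+ 2) x 1.
  under eq_fun do rewrite !big_ord_recr big_ord0 /=.
  have hsq i : derivable (fun y => u y ord0 i ^+ 2) x 1.
    have hi : derivable (fun y => u y ord0 i) x 1.
      by move/derivable_mxP : hu; apply.
    exact: (derivableM hi hi).
  by do 3![apply: derivableD => //]; exact: derivable_cst.
rewrite -[@enorm R \o u]/(Num.sqrt \o fun y => \sum_(i < 3) u y ord0 i ^+ 2).
apply/derivable1_diffP; apply: differentiable_comp.
  exact/derivable1_diffP.
have ? := is_derive1_sqrt S_gt0.
by apply/derivable1_diffP; exact: ex_derive.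
Qed.

(** * Cross product and curvature *)

Lemma vec3_coord (R : realType) (u : 'rV[R]_3) :
  u = vec3 (u ord0 (inord 0)) (u ord0 (inord 1)) (u ord0 (inord 2)).
Proof.
apply/rowP => i; rewrite mxE; case: i => [[|[|[|//]]]] lti /=;
  by congr (u _ _); apply/val_inj; rewrite /= inordK.
Qed.

Lemma scale_vec3 (R : realType) (k a b c : R) :
  k *: vec3 a b c = vec3 (k * a) (k * b) (k * c).
Proof. by apply/rowP => i; rewrite !mxE; case: i => [[|[|[|]]]]. Qed.

Lemma add_vec3 (R : realType) (a b c a' b' c' : R) :
  vec3 a b c + vec3 a' b' c' = vec3 (a + a') (b + b') (c + c').
Proof. by apply/rowP => i; rewrite !mxE; case: i => [[|[|[|]]]]. Qed.

Lemma crossv_vec3 (R : realType) (a b c a' b' c' : R) :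
  crossv (vec3 a b c) (vec3 a' b' c') =
    vec3 (b * c' - c * b') (c * a' - a * c') (a * b' - b * a').
Proof. by rewrite /crossv !mxE !inordK. Qed.

Lemma enorm_vec3 (R : realType) (a b c : R) :
  enorm (vec3 a b c) = Num.sqrt (a ^+ 2 + b ^+ 2 + c ^+ 2).
Proof. by rewrite /enorm !big_ord_recr big_ord0 /= add0r !mxE. Qed.

(** The [q *: u] summand disappears because parallel vectors have zero cross
    product. *)
Lemma crossv_scale_comb (R : realType) (u v : 'rV[R]_3) (p q r : R) :
  crossv (p *: u) (q *: u + r *: v) = (p * r) *: crossv u v.
Proof.
rewrite [u]vec3_coord [v]vec3_coord !(scale_vec3, add_vec3, crossv_vec3).
by congr vec3; ring.
Qed.

(** The derivative of the speed only contributes a tangential term to the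
    second arclength derivative, so it is never computed: knowing that it exists
    is enough. *)
Lemma crossv_arclength_derive (R : realType) (gamma : R -> 'rV[R]_3) (x : R) :
  derivable (derive1 gamma) x 1 -> enorm (derive1 gamma x) != 0 ->
  let Ds := arclength_derive gamma in
  crossv (Ds gamma x) (Ds (Ds gamma) x) =
    enorm (derive1 gamma x) ^- 3 *: crossv (derive1 gamma x) (derive1n 2 gamma x).
Proof.
move=> dv w0 Ds.
have dp : derivable (fun y => (enorm (derive1 gamma y))^-1) x 1.
  by apply: derivableV => //; exact: derivable_enorm.
have [_ dT] := is_derive_scalemx _ _ _ _ _ _ _ _ (derivableP dp) (derivableP dv).
rewrite -[Ds (Ds gamma) x]/((enorm (derive1 gamma x))^-1 *: derive1 (Ds gamma) x).
rewrite [derive1 (Ds gamma) x]derive1E dT scalerDr !scalerA crossv_scale_comb.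
rewrite -[derive1n 2 gamma x]/(derive1 (derive1 gamma) x).
rewrite [derive1 (derive1 gamma) x]derive1E.
by congr (_ *: _); rewrite exprSr expr2 !invfM mulrA.
Qed.

(** * The rotating curve *)

Lemma rotating_curve_dt (R : realType) (f : R -> R) (x t : R) :
  derive1 (rotating_curve f x) t = vec3 0 (- sin t * f x) (- cos t * f x).
Proof.
rewrite derive1E; apply: derive_val; apply: is_derive_vec3.
- by apply: is_derive_eq; rewrite /GRing.scale /=; ring.
- by apply: is_derive_eq; rewrite /GRing.scale /=; ring.
Qed.

Lemma is_derive_rotating_curve (R : realType) (f : R -> R) (t y : R) :
  derivable f y 1 ->
  is_derive y 1 (fun z => rotating_curve f z t)
    (vec3 1 (cos t * derive1 f y) (- sin t * derive1 f y)).
Proof.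
move=> /derivableP df; rewrite derive1E.
by apply: is_derive_vec3; apply: is_derive_eq; rewrite /GRing.scale /=; ring.
Qed.

Theorem corollary3p4p2 (R : realType) (I J : set R) (f : R -> R)
    (openI : open I) (itvI : is_interval I)
    (openJ : open J) (itvJ : is_interval J) (J0 : J !=set0)
    (smoothf : smooth_on I f)
    (vfe : vortex_filament_equation I J (rotating_curve f)) :
  forall x : R, I x ->
    f x + derive1n 2 f x / (1 + derive1 f x ^+ 2) `^ (3 / 2) = 0.
Proof.
move=> x Ix; have [t Jt] := J0.
pose gamma y := rotating_curve f y t.
have v1 y : I y ->
    derive1 gamma y = vec3 1 (cos t * derive1 f y) (- sin t * derive1 f y).
  move=> Iy; rewrite derive1E; apply: derive_val.
  by apply: is_derive_rotating_curve; exact: (smoothf 0%N).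
have v2 : is_derive x 1 (derive1 gamma)
    (vec3 0 (cos t * derive1n 2 f x) (- sin t * derive1n 2 f x)).
  (* The formula for the velocity is known only on [I], which is a neighbourhood
     of [x]; that is enough to differentiate it once more at [x]. *)
  apply: (@near_eq_is_derive _ _ _ (fun y =>
    vec3 1 (cos t * derive1 f y) (- sin t * derive1 f y))).
    by apply: filterS (open_nbhs_nbhs (conj openI Ix)) => y Iy; rewrite v1.
  have df' : is_derive x 1 (derive1 f) (derive1n 2 f x).
    by rewrite derive1nS derive1E; apply: derivableP; exact: (smoothf 1%N).
  by apply: is_derive_vec3; apply: is_derive_eq; rewrite /GRing.scale /=; ring.
have w2_gt0 : 0 < 1 + derive1 f x ^+ 2 by rewrite ltr_wpDr// sqr_ge0.
have wE : enorm (derive1 gamma x) = Num.sqrt (1 + derive1 f x ^+ 2).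
  by rewrite v1// enorm_vec3; congr Num.sqrt; ring: (cos2sin2 t).
have w_gt0 : 0 < Num.sqrt (1 + derive1 f x ^+ 2) by rewrite sqrtr_gt0.
have := vfe x t Ix Jt; cbv zeta.
rewrite rotating_curve_dt crossv_arclength_derive -/gamma; last 2 first.
- exact: ex_derive.
- by rewrite wE gt_eqF.
have -> : derive1n 2 gamma x =
    vec3 0 (cos t * derive1n 2 f x) (- sin t * derive1n 2 f x).
  by rewrite derive1nS derive1E derive_val.
rewrite wE v1// crossv_vec3 scale_vec3.
have -> : (1 + derive1 f x ^+ 2) `^ (3 / 2) =
    Num.sqrt (1 + derive1 f x ^+ 2) ^+ 3.
  by rewrite mulrC powRrM powR12_sqrt ?ltW// powR_mulrn ?ltW.
(* The first coordinate is trivial; the other two carry the equation multiplied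
   by [sin t] and by [cos t]. *)
set k := _ ^- 3; move=> /rowP eqv.
have := eqv (inord 1); have := eqv (inord 2); rewrite !mxE !inordK //= => e2 e1.
set F := _ + _.
have sF : sin t * F = 0.
  by apply: oppr_inj; rewrite oppr0 /F mulrDr opprD -mulNr e1; ring.
have cF : cos t * F = 0.
  by apply: oppr_inj; rewrite oppr0 /F mulrDr opprD -mulNr e2; ring.
by rewrite -[F]mul1r -(cos2Dsin2 t) mulrDl !expr2 -!mulrA sF cF !mulr0 addr0.
Qed.
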